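(* Let $L$ be a non-negative integer, $f$ a positive integer, and for non-negative integers $n_1,\dots,n_f$ put $N_i:=n_i+n_{i+1}+\dots+n_f$ for $i=1,\dots,f$. Then \[ \sum_{m,n,n_1,\dots,n_f\geq 0}\frac{q^{2m^2+6mn+6n^2+N_1^2+\dots+N_f^2}(q;q)_{2L}(q;q)_{n_f}}{(q;q)_m(q^3;q^3)_n(q;q)_{L-N_1}(q;q)_{n_f-3n-2m}(q;q)_{n_1}\cdots(q;q)_{n_{f-1}}(q;q)_{2n_f}}=\sum_{j=-L}^{L}\left(\frac{j+1}{3}\right)q^{(f+1)j^2}{2L\brack L-j}_q. \]
   Context: $(a;p)_n=\prod_{k=0}^{n-1}(1-ap^k)$ for a base $p$. By convention $1/(q;q)_n=0$ for negative integers $n$, so summands with a negative index in a denominator vanish. The $q$-binomial coefficient is ${m+n\brack m}_q=\frac{(q;q)_{m+n}}{(q;q)_m(q;q)_n}$ for $m,n\ge0$ and $0$ otherwise. $\left(\frac{a}{3}\right)$ denotes the Jacobi symbol modulo 3: $0$ if $3\mid a$, $1$ if $a\equiv1\pmod 3$, $-1$ if $a\equiv 2\pmod 3$. *)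

(* Defs.v *)
From HB Require Import structures.
From mathcomp Require Export all_boot all_order all_algebra.
From mathcomp Require Export classical_sets fsbigop.
Set Implicit Arguments.
Unset Strict Implicit.
Unset Printing Implicit Defensive.
Import GRing.Theory.
Local Open Scope ring_scope.

(* (a; p)_n *)
Definition qpoch (F : fieldType) (a p : F) (n : nat) : F :=
  \prod_(k < n) (1 - a * p ^+ k).

(* 1 / (p; p)_n, with the convention that it is 0 for n < 0 *)
Definition qpochV (F : fieldType) (p : F) (n : int) : F :=
  match n with
  | Posz k => (qpoch p p k)^-1
  | Negz _ => 0
  end.

(* [a; b]_p: writing a = m + n with m = b, it is 0 unless m, n >= 0 *)
Definition qbinom (F : fieldType) (p : F) (a b : int) : F :=
  match b, a - b with
  | Posz m, Posz n => qpoch p p (m + n)%N / (qpoch p p m * qpoch p p n)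
  | _, _ => 0
  end.

Definition jacobi3 (a : int) : int :=
  if (3%:Z %| a)%Z then 0 else
  if (a == 1 %[mod 3%:Z])%Z then 1 else -1.

(* n_i, with i counted from 1 *)
Definition nidx (f : nat) (ns : f.-tuple nat) (i : nat) : nat :=
  nth 0%N ns i.-1.

(* N_i = n_i + ... + n_f *)
Definition Nidx (f : nat) (ns : f.-tuple nat) (i : nat) : nat :=
  (\sum_(i <= k < f.+1) nidx ns k)%N.

Definition summand (F : fieldType) (q : F) (L f m n : nat)
    (ns : f.-tuple nat) : F :=
  q ^+ (2 * m ^ 2 + 6 * m * n + 6 * n ^ 2
        + \sum_(1 <= i < f.+1) Nidx ns i ^ 2)%N
  * qpoch q q (2 * L)%N * qpoch q q (nidx ns f)
  / (qpoch q q m * qpoch (q ^+ 3) (q ^+ 3) n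
     * (\prod_(1 <= i < f) qpoch q q (nidx ns i))
     * qpoch q q (2 * nidx ns f)%N)
  * qpochV q (L%:Z - (Nidx ns 1)%:Z)
  * qpochV q ((nidx ns f)%:Z - 3%:Z * n%:Z - 2%:Z * m%:Z).

(* Main.v *)
Require Import Defs.
From mathcomp Require Import ring zify.
Set Implicit Arguments.
Unset Strict Implicit.
Unset Printing Implicit Defensive.
Import Order.TTheory GRing.Theory Num.Theory.
Local Open Scope ring_scope.

(** By the q-Vandermonde identity, the sum over r of
    q^(r^2) / ((q)_(L-r) (q)_(r-j) (q)_(r+j)) is q^(j^2) / ((q)_(L-j) (q)_(L+j)).
    Applied to the outermost index r = N_1, this trades one summation index for
    one factor q^(j^2), so everything reduces to the identity
<<
      (q)_r / (q)_2r * \sum_(m,n) t(m,n) / (q)_(r-3n-2m)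
        = \sum_j ((j+1)/3) q^(j^2) / ((q)_(r-j) (q)_(r+j))
>>
    with t(m,n) = q^(2m^2+6mn+6n^2) / ((q)_m (q^3;q^3)_n).  Both sides satisfy
    the same second-order recurrence in r.  On the right it comes from the
    recurrence of the q^(-1)-Rogers-Szego polynomials, specialized by means of
    (j/3) + ((j+1)/3) + ((j+2)/3) = 0.  On the left one collects the terms with
    2m + 3n = k into c_k: the generating function of q^(-k^2/2) c_k is an
    infinite product, which yields a fourth-order recurrence for c_k; this
    recurrence factors, and the resulting third-order one is convolved with
    1 / (q)_k.  No power of q is ever inverted, since q = 0 is allowed. *)

Section QSeries.
Variables (F : fieldType) (q : F).
Hypothesis q_nroot : forall k : nat, (0 < k)%N -> q ^+ k != 1.

Local Notation e := (qpochV q).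
Local Arguments qpochV : simpl never.

(** * Reciprocal q-Pochhammer symbols *)

Lemma qpochS (a p : F) n : qpoch a p n.+1 = qpoch a p n * (1 - a * p ^+ n).
Proof. by rewrite /qpoch big_ord_recr. Qed.

Lemma qpoch0 (a p : F) : qpoch a p 0 = 1.
Proof. by rewrite /qpoch big_ord0. Qed.

Lemma qpoch_neq0 n : qpoch q q n != 0.
Proof.
apply/prodf_neq0 => k _; rewrite -exprS subr_eq0 eq_sym; exact: q_nroot.
Qed.

Lemma qpoch_cube_neq0 n : qpoch (q ^+ 3) (q ^+ 3) n != 0.
Proof.
apply/prodf_neq0 => k _; rewrite -exprS -exprM subr_eq0 eq_sym.
by apply: q_nroot; rewrite muln_gt0.
Qed.

Lemma qpochV_neg (i : int) : i < 0 -> e i = 0.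
Proof. by case: i. Qed.

Lemma qpochV0 : e 0%N = 1.
Proof. by rewrite /qpochV qpoch0 invr1. Qed.

Lemma qpochVS (n : nat) : e n = (1 - q ^+ n.+1) * e n.+1.
Proof.
rewrite /qpochV qpochS -exprS invfM mulrCA mulrV ?mulr1 // unitfE subr_eq0 eq_sym.
exact: q_nroot.
Qed.

Lemma qpochV_pred (n : nat) : e (n%:Z - 1) = (1 - q ^+ n) * e n.
Proof.
case: n => [|n]; first by rewrite expr0 subrr mul0r.
by rewrite -qpochVS; congr (e _); lia.
Qed.

Lemma qpochV_pred2 (n : nat) :
  e (n%:Z - 2) = (1 - q ^+ n) * (1 - q ^+ n.-1) * e n.
Proof.
case: n => [|n]; first by rewrite expr0 subrr !mul0r.
have -> : n.+1%:Z - 2 = n%:Z - 1 by lia.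
by rewrite qpochV_pred qpochVS mulrCA mulrA.
Qed.

(** * The q-Vandermonde identity and the Bailey step *)

Lemma q_vandermonde (A c : nat) :
  \sum_(s < A.+1) q ^+ (s * (s + c)) * e s * e (A - s)%N * e (s + c)%N
  = e A * e (A + c)%N.
Proof.
elim: A c => [|A IH] c.
  by rewrite big_ord1 mul0n expr0 subn0 !add0n qpochV0 !mul1r.
have nz : 1 - q ^+ A.+1 != 0 by rewrite subr_eq0 eq_sym q_nroot.
apply: (mulfI nz); rewrite mulrA -qpochVS addSnnS -IH mulr_sumr.
(* From 1 - q^(A+1) = (1 - q^s) + q^s (1 - q^(A+1-s)). The first piece vanishes at s = 0, the second
   at s = A+1; after a shift of the first they add up to the summand for A and c+1. *)
have split_term (s : 'I_A.+2) :
  (1 - q ^+ A.+1) * (q ^+ (s * (s + c)) * e s * e (A.+1 - s)%N * e (s + c)%N)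
  = (q ^+ (s * (s + c)) * ((1 - q ^+ s) * e s) * e (A.+1 - s)%N * e (s + c)%N)
  + (q ^+ (s * (s + c) + s) * e s * ((1 - q ^+ (A.+1 - s)) * e (A.+1 - s)%N)
     * e (s + c)%N).
  have -> : q ^+ A.+1 = q ^+ s * q ^+ (A.+1 - s).
    by rewrite -exprD subnKC // -ltnS.
  by rewrite exprD; ring.
rewrite (eq_bigr _ (fun s _ => split_term s)) big_split /= {split_term}.
rewrite big_ord_recl expr0 subrr mul0r mulr0 !mul0r add0r.
rewrite [X in _ + X]big_ord_recr /= subnn expr0 subrr mul0r mulr0 mul0r addr0.
rewrite -big_split /=; apply: eq_bigr => s _.
have sA : (s <= A)%N by rewrite -ltnS.
rewrite /bump /= add1n subSS -qpochVS subSn // -qpochVS.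
rewrite addSn addnS [e (s + c)%N]qpochVS.
have -> : (s.+1 * (s + c).+1 = s * (s + c).+1 + (s + c).+1)%N by lia.
have -> : (s * (s + c) + s = s * (s + c).+1)%N by lia.
by rewrite exprD; ring.
Qed.

(** Only |j| <= r <= L contribute. Setting r = s + |j| turns r^2 into j^2 + s(s + 2|j|), which gives
    [q_vandermonde] with A = L - |j| and c = 2|j|. *)
Lemma bailey_step (B L : nat) (j : int) : (L < B)%N ->
  \sum_(r < B) q ^+ (r ^ 2) * e (L%:Z - r%:Z) * (e (r%:Z - j) * e (r%:Z + j))
  = q ^+ (`|j| ^ 2) * (e (L%:Z - j) * e (L%:Z + j)).
Proof.
move=> LB.
wlog [k ->] : j / exists k : nat, j = k.
  move=> wl; case: j => k; first by apply: wl; exists k.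
  have := wl k.+1%:Z (ex_intro _ _ erefl).
  have -> : `|Negz k|%N = `|k.+1%:Z|%N by lia.
  rewrite [e (L%:Z - Negz k) * _]mulrC.
  have -> : L%:Z + Negz k = L%:Z - k.+1%:Z by lia.
  have -> : L%:Z - Negz k = L%:Z + k.+1%:Z by lia.
  move=> <-; apply: eq_bigr => r _; rewrite [e (r%:Z - Negz k) * _]mulrC.
  have -> : r%:Z + Negz k = r%:Z - k.+1%:Z by lia.
  by have -> : r%:Z - Negz k = r%:Z + k.+1%:Z by lia.
rewrite absz_nat.
have [Lk|kL] := ltnP L k.
  rewrite (qpochV_neg (_ : L%:Z - k%:Z < 0)); last by lia.
  rewrite mul0r mulr0 big1 // => r _.
  have [rL|Lr] := leqP r L.
    by rewrite (qpochV_neg (_ : r%:Z - k%:Z < 0)) ?mul0r ?mulr0 //; lia.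
  by rewrite (qpochV_neg (_ : L%:Z - r%:Z < 0)) ?mulr0 ?mul0r //; lia.
rewrite -(big_mkord xpredT (fun r => q ^+ (r ^ 2) * e (L%:Z - r%:Z)
  * (e (r%:Z - k%:Z) * e (r%:Z + k%:Z)))).
rewrite (@big_cat_nat _ _ _ L.+1) //= [X in _ + X]big_nat [X in _ + X]big1 ?addr0; last first.
  move=> r /andP[Lr _].
  by rewrite (qpochV_neg (_ : L%:Z - r%:Z < 0)) ?mulr0 ?mul0r //; lia.
rewrite (@big_cat_nat _ _ _ k) //=; last by lia.
rewrite [X in X + _]big_nat [X in X + _]big1 ?add0r; last first.
  move=> r /andP[_ rk].
  by rewrite (qpochV_neg (_ : r%:Z - k%:Z < 0)) ?mul0r ?mulr0 //; lia.
have -> : e (L%:Z - k%:Z) * e (L%:Z + k%:Z)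
          = e (L - k)%N * e (L - k + 2 * k)%N.
  by congr (e _ * e _); lia.
rewrite -q_vandermonde mulr_sumr -{1}[k]add0n big_addn big_mkord subSn //.
apply: eq_bigr => s _; have sL := ltn_ord s.
have -> : L%:Z - (s + k)%N%:Z = (L - k - s)%N by lia.
have -> : (s + k)%N%:Z - k%:Z = s by lia.
have -> : (s + k)%N%:Z + k%:Z = (s + 2 * k)%N by lia.
have -> : ((s + k) ^ 2 = k ^ 2 + s * (s + 2 * k))%N by lia.
by rewrite exprD; ring.
Qed.

(** * Sums weighted by the Jacobi symbol and their recurrence *)

(** Up to the factor q^(r^2) / (q)_2r, a coefficient of the q^(-1)-Rogers-Szego polynomial of degree
    2r, free of negative powers of q. *)
Definition qsqbin (r j : int) : F := q ^+ (`|j| ^ 2) * (e (r - j) * e (r + j)).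

Lemma qsqbinN r j : qsqbin r (- j) = qsqbin r j.
Proof. by rewrite /qsqbin abszN opprK mulrC [X in X * _]mulrC mulrC. Qed.

Lemma qsqbin_eq0 (r : nat) (j : int) : (r < `|j|)%N -> qsqbin r j = 0.
Proof.
rewrite /qsqbin; case: j => [k|k] rk.
  by rewrite (qpochV_neg (_ : r%:Z - k%:Z < 0)) ?mul0r ?mulr0 //; lia.
by rewrite (qpochV_neg (_ : r%:Z + Negz k < 0)) ?mulr0 //; lia.
Qed.

Lemma qsqbin_rec (r : nat) (j : int) :
  (1 - q ^+ (2 * r + 2)) * (1 - q ^+ (2 * r + 1)) * qsqbin r.+1 j
  = (1 + q) * qsqbin r j
    + q ^+ (2 * r + 1) * (qsqbin r (j - 1) + qsqbin r (j + 1))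
    - q * qsqbin (r%:Z - 1) j.
Proof.
wlog [k ->] : j / exists k : nat, j = k.
  move=> wl; case: j => k; first by apply: wl; exists k.
  have := wl k.+1%:Z (ex_intro _ _ erefl).
  have -> : Negz k = - k.+1%:Z by lia.
  rewrite -!opprD.
  have -> : - k.+1%:Z + 1 = - (k.+1%:Z - 1) by lia.
  by rewrite !qsqbinN [qsqbin _ (_ + 1) + _]addrC.
have [kr|rk] := ltnP r.+1 k.
  rewrite (_ : qsqbin (r%:Z - 1) k = 0); last first.
    by rewrite /qsqbin (qpochV_neg (_ : r%:Z - 1 - k%:Z < 0)) ?mul0r ?mulr0 //; lia.
  by rewrite !qsqbin_eq0 ?addr0 ?mulr0 ?subr0 ?addr0 //; lia.
(* All terms are multiples of q^(k^2) [e d * e v], which leaves a polynomial identity in powers of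
   q. *)
pose d := (r.+1 - k)%N; pose v := (r.+1 + k)%N.
rewrite /qsqbin.
have -> : r.+1%:Z - k%:Z = d by lia.
have -> : r.+1%:Z + k%:Z = v by lia.
have -> : r%:Z - k%:Z = d%:Z - 1 by lia.
have -> : r%:Z + k%:Z = v%:Z - 1 by lia.
have -> : r%:Z - 1 - k%:Z = d%:Z - 2 by lia.
have -> : r%:Z - 1 + k%:Z = v%:Z - 2 by lia.
have -> : r%:Z - (k%:Z - 1) = d by lia.
have -> : r%:Z + (k%:Z - 1) = v%:Z - 2 by lia.
have -> : r%:Z - (k%:Z + 1) = d%:Z - 2 by lia.
have -> : r%:Z + (k%:Z + 1) = v by lia.
rewrite [q ^+ _ * (_ + _)]mulrDr !mulrA -!exprD absz_nat.
have -> : (2 * r + 1 + absz (k%:Z - 1)%R ^ 2 = k ^ 2 + d + d)%N by rewrite /d; nia.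
have -> : (2 * r + 1 + absz (k%:Z + 1)%R ^ 2 = k ^ 2 + v + v)%N by rewrite /v; nia.
have -> : (2 * r + 2 = d + v)%N by lia.
have -> : (2 * r + 1 = (d + v).-1)%N by lia.
have v_gt0 : (0 < v)%N by lia.
clearbody d v; rewrite !qpochV_pred // !qpochV_pred2 // !exprD.
case: v v_gt0 => // v _; case: d => [|d].
  by rewrite !expr0 /= !exprS; ring.
by rewrite addSn /= !exprD !exprS; ring.
Qed.

Definition jweight (j : int) : F := (jacobi3 (j + 1))%:~R.

Lemma jacobi3_sum3 j : jacobi3 j + jacobi3 (j + 1) + jacobi3 (j + 2) = 0.
Proof.
have dvd3E a : (3%:Z %| a)%Z = ((a %% 3%:Z)%Z == 0) by exact/dvdz_mod0P/eqP.
by rewrite /jacobi3 !dvd3E; do ?case: ifP; lia.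
Qed.

Lemma jweight_sum (j : int) : jweight (j - 1) + jweight (j + 1) = - jweight j.
Proof.
rewrite /jweight -intrD -intrN; congr (_ %:~R).
have := jacobi3_sum3 j; rewrite subrK (_ : j + 1 + 1 = j + 2); last by lia.
by move=> E; lia.
Qed.

Definition wsum N (phi : int -> F) : F :=
  \sum_(i < (2 * N).+1) phi (i%:Z - N%:Z).

Lemma wsum_shift N (phi : int -> F) :
  phi (- N%:Z) = 0 -> phi N.+1 = 0 -> wsum N (fun j => phi (j + 1)) = wsum N phi.
Proof.
move=> phiN phiS; rewrite /wsum big_ord_recr big_ord_recl /=.
have -> : (2 * N)%:Z - N%:Z + 1 = N.+1 by lia.
rewrite phiS addr0 (_ : 0%N%:Z - N%:Z = - N%:Z) ?phiN ?add0r; last by lia.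
apply: eq_bigr => i _.
by rewrite /bump /=; congr phi; lia.
Qed.

(* The window parameter N is immaterial as soon as N >= r. *)
Definition jsum N (k : nat) (r : int) : F :=
  wsum N (fun j => jweight j * q ^+ (k * `|j| ^ 2) * (e (r - j) * e (r + j))).

Lemma jsum1E N r : jsum N 1 r = wsum N (fun j => jweight j * qsqbin r j).
Proof. by apply: eq_bigr => i _; rewrite mul1n -mulrA. Qed.

(** In [qsqbin_rec] summed over j, the shifts j - 1 and j + 1 move onto the weight, where
    [jweight_sum] merges them. As r < N, nothing is lost at the ends of the window. *)
Lemma jsum_rec N (r : nat) : (r < N)%N ->
  (1 - q ^+ (2 * r + 2)) * (1 - q ^+ (2 * r + 1)) * jsum N 1 r.+1
  = (1 + q - q ^+ (2 * r + 1)) * jsum N 1 r - q * jsum N 1 (r%:Z - 1).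
Proof.
move=> rN; rewrite !jsum1E.
have sh1 : wsum N (fun j => jweight j * qsqbin r (j + 1))
         = wsum N (fun j => jweight (j - 1) * qsqbin r j).
  rewrite -[RHS]wsum_shift; first by apply: eq_bigr => i _; rewrite addrK.
    by rewrite qsqbin_eq0 ?mulr0 //; lia.
  by rewrite qsqbin_eq0 ?mulr0 //; lia.
have sh2 : wsum N (fun j => jweight j * qsqbin r (j - 1))
         = wsum N (fun j => jweight (j + 1) * qsqbin r j).
  rewrite -[LHS]wsum_shift; first by apply: eq_bigr => i _; rewrite addrK.
    by rewrite qsqbin_eq0 ?mulr0 //; lia.
  by rewrite qsqbin_eq0 ?mulr0 //; lia.
have sh : wsum N (fun j => jweight j * qsqbin r (j - 1))
        + wsum N (fun j => jweight j * qsqbin r (j + 1))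
        = - wsum N (fun j => jweight j * qsqbin r j).
  rewrite sh1 sh2 /wsum -big_split -sumrN; apply: eq_bigr => i _ /=.
  by rewrite -mulrDl [X in X * _]addrC jweight_sum mulNr.
transitivity ((1 + q) * wsum N (fun j => jweight j * qsqbin r j)
  + q ^+ (2 * r + 1) * (wsum N (fun j => jweight j * qsqbin r (j - 1))
                        + wsum N (fun j => jweight j * qsqbin r (j + 1)))
  - q * wsum N (fun j => jweight j * qsqbin (r%:Z - 1) j)); last by rewrite sh; ring.
rewrite /wsum -big_split !mulr_sumr -big_split -sumrB; apply: eq_bigr => i _ /=.
by rewrite mulrCA qsqbin_rec; ring.
Qed.

Lemma jsum_bailey N B k (L : nat) : (L < B)%N ->
  jsum N k.+1 L = \sum_(r < B) q ^+ (r ^ 2) * e (L%:Z - r%:Z) * jsum N k r.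
Proof.
move=> LB; rewrite /jsum /wsum.
under [RHS]eq_bigr do rewrite mulr_sumr.
rewrite exchange_big /=; apply: eq_bigr => i _; set j : int := _ - _.
transitivity (jweight j * q ^+ (k * `|j| ^ 2)
  * (q ^+ (`|j| ^ 2) * (e (L%:Z - j) * e (L%:Z + j)))).
  by rewrite mulSn exprD; ring.
by rewrite -(bailey_step _ LB) mulr_sumr; apply: eq_bigr => r _; rewrite mulrCA.
Qed.

Lemma sum_ord_trunc a b (phi : nat -> F) : (a <= b)%N ->
  (forall i, (a <= i)%N -> phi i = 0) -> \sum_(i < b) phi i = \sum_(i < a) phi i.
Proof.
move=> ab phi0; rewrite -!(big_mkord xpredT) (@big_cat_nat _ _ _ a) //=.
by rewrite [X in _ + X]big_nat [X in _ + X]big1 ?addr0 // => i /andP[/phi0].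
Qed.

Definition diagsum (phi : nat -> nat -> F) (k : nat) : F :=
  \sum_(m < k.+1) \sum_(n < k.+1) (2 * m + 3 * n == k)%N%:R * phi m n.

Lemma diagsum_box M N (phi : nat -> nat -> F) k : (k < M)%N -> (k < N)%N ->
  \sum_(m < M) \sum_(n < N) (2 * m + 3 * n == k)%N%:R * phi m n = diagsum phi k.
Proof.
move=> kM kN; rewrite (@sum_ord_trunc k.+1 M (fun m =>
  \sum_(n < N) (2 * m + 3 * n == k)%N%:R * phi m n)) //.
  apply: eq_bigr => m _.
  rewrite (@sum_ord_trunc k.+1 N (fun n => (2 * m + 3 * n == k)%N%:R * phi m n)) //.
  by move=> n kn; rewrite (_ : _ == k = false) ?mul0r //; lia.
move=> m km; rewrite big1 // => n _.
by rewrite (_ : _ == k = false) ?mul0r //; lia.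
Qed.

Lemma eq_diagsum phi psi k :
  (forall m n, (2 * m + 3 * n)%N = k -> phi m n = psi m n) ->
  diagsum phi k = diagsum psi k.
Proof.
move=> E; apply: eq_bigr => m _; apply: eq_bigr => n _.
by case: eqP => [/E ->|_]; rewrite ?mul0r.
Qed.

Lemma diagsumZ a phi k : diagsum (fun m n => a * phi m n) k = a * diagsum phi k.
Proof.
rewrite /diagsum mulr_sumr; apply: eq_bigr => m _.
by rewrite mulr_sumr; apply: eq_bigr => n _; rewrite mulrCA.
Qed.

Lemma diagsumD phi psi k :
  diagsum (fun m n => phi m n + psi m n) k = diagsum phi k + diagsum psi k.
Proof.
rewrite /diagsum -big_split; apply: eq_bigr => m _.
by rewrite -big_split; apply: eq_bigr => n _ /=; rewrite mulrDr.
Qed.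

Lemma diagsum_shift_l phi k : (forall n, phi 0%N n = 0) ->
  diagsum phi k.+2 = diagsum (fun m n => phi m.+1 n) k.
Proof.
move=> phi0; rewrite -[RHS](@diagsum_box k.+1 k.+3) //; last by lia.
rewrite /diagsum big_ord_recl [X in X + _]big1 ?add0r; last first.
  by move=> n _; rewrite phi0 mulr0.
rewrite (@sum_ord_trunc k.+1 k.+2 (fun m =>
  \sum_(n < k.+3) (2 * m.+1 + 3 * n == k.+2)%N%:R * phi m.+1 n)) //.
  by do 2 apply: eq_bigr => ? _; congr (_%:R * _); lia.
move=> m km; rewrite big1 // => n _.
by rewrite (_ : _ == k.+2 = false) ?mul0r //; lia.
Qed.

Lemma diagsum_shift_r phi k : (forall m, phi m 0%N = 0) ->
  diagsum phi k.+3 = diagsum (fun m n => phi m n.+1) k.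
Proof.
move=> phi0; rewrite -[RHS](@diagsum_box k.+4 k.+1) //; last by lia.
apply: eq_bigr => m _; rewrite big_ord_recl phi0 mulr0 add0r.
rewrite (@sum_ord_trunc k.+1 k.+3 (fun n =>
  (2 * m + 3 * n.+1 == k.+3)%N%:R * phi m n.+1)) //; last 2 first.
- by lia.
- by move=> n kn; rewrite (_ : _ == k.+3 = false) ?mul0r //; lia.
by apply: eq_bigr => ? _; congr (_%:R * _); lia.
Qed.

Lemma diagsum_small_l phi k : (k < 2)%N -> (forall n, phi 0%N n = 0) ->
  diagsum phi k = 0.
Proof.
move=> k2 phi0; rewrite /diagsum big1 // => m _; rewrite big1 // => n _.
case: eqP => [E|]; rewrite ?mul0r // mul1r.
by rewrite (_ : nat_of_ord m = 0%N) ?phi0 //; lia.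
Qed.

Lemma diagsum_small_r phi k : (k < 3)%N -> (forall m, phi m 0%N = 0) ->
  diagsum phi k = 0.
Proof.
move=> k3 phi0; rewrite /diagsum big1 // => m _; rewrite big1 // => n _.
case: eqP => [E|]; rewrite ?mul0r // mul1r.
by rewrite (_ : nat_of_ord n = 0%N) ?phi0 //; lia.
Qed.

(** * Recurrences for the coefficients c_k *)

Definition capp_term (m n : nat) : F :=
  q ^+ (2 * m ^ 2 + 6 * m * n + 6 * n ^ 2)
  / (qpoch q q m * qpoch (q ^+ 3) (q ^+ 3) n).

(** Raising m by one adds 2 + 2(2m + 3n) to the exponent, so apart from 1 - q^(m+1) the ratio
    depends only on the weight 2m + 3n. *)
Lemma capp_term_Sl m n :
  (1 - q ^+ m.+1) * capp_term m.+1 n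
  = q ^+ 2 * (q ^+ (2 * m + 3 * n)) ^+ 2 * capp_term m n.
Proof.
rewrite /capp_term qpochS -exprS.
have -> : (2 * m.+1 ^ 2 + 6 * m.+1 * n + 6 * n ^ 2
           = 2 + (2 * m + 3 * n) * 2 + (2 * m ^ 2 + 6 * m * n + 6 * n ^ 2))%N.
  by lia.
rewrite exprD [q ^+ (2 + _)]exprD [q ^+ (_ * 2)]exprM; field.
by rewrite qpoch_neq0 // qpoch_cube_neq0 // subr_eq0 eq_sym q_nroot.
Qed.

(** Raising n by one adds 6m + 12n + 6 to the exponent; the extra q^(2m) completes this to 6 + 4(2m
    + 3n), again a function of the weight. *)
Lemma capp_term_Sr m n :
  q ^+ (2 * m) * (1 - q ^+ (3 * n.+1)) * capp_term m n.+1
  = q ^+ 6 * (q ^+ (2 * m + 3 * n)) ^+ 4 * capp_term m n.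
Proof.
rewrite /capp_term qpochS -exprS -!exprM.
have -> : (2 * m ^ 2 + 6 * m * n.+1 + 6 * n.+1 ^ 2
           = 6 + (6 * m + 12 * n) + (2 * m ^ 2 + 6 * m * n + 6 * n ^ 2))%N.
  by lia.
have -> : ((2 * m + 3 * n) * 4 = 2 * m + (6 * m + 12 * n))%N by lia.
rewrite exprD [q ^+ (6 + _)]exprD [q ^+ (2 * m + _)]exprD; field.
by rewrite qpoch_neq0 // qpoch_cube_neq0 // subr_eq0 eq_sym q_nroot.
Qed.

Definition capp := diagsum capp_term.


(** The factors vanish where m or n cannot be lowered, so shifting m once, m twice or n once
    expresses the three sums by [capp] at k - 2, k - 4 and k - 3. *)
Definition cappX := diagsum (fun m n => (1 - q ^+ m) * capp_term m n).
Definition cappY :=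
  diagsum (fun m n => (1 - q ^+ m.-1) * ((1 - q ^+ m) * capp_term m n)).
Definition cappZ :=
  diagsum (fun m n => q ^+ (2 * m) * (1 - q ^+ (3 * n)) * capp_term m n).

(** Termwise, 1 - q^(2m+3n) = (1 - q^(2m)) + q^(2m) (1 - q^(3n)), and 1 - q^(2m) = (1 + q)(1 - q^m)
    - q (1 - q^(m-1))(1 - q^m). *)
Lemma capp_split k :
  (1 - q ^+ k) * capp k = (1 + q) * cappX k - q * cappY k + cappZ k.
Proof.
rewrite /capp /cappX /cappY /cappZ -mulNr -!diagsumZ -!diagsumD.
apply: eq_diagsum => m n <-; case: m => [|m].
  by rewrite muln0 add0n expr0; ring.
by rewrite mul2n -addnn exprD [q ^+ (m.+1 + _)]exprD /= exprS; ring.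
Qed.

Lemma cappX_SS k : cappX k.+2 = q ^+ 2 * (q ^+ k) ^+ 2 * capp k.
Proof.
rewrite /cappX diagsum_shift_l; last by move=> n; rewrite expr0 subrr mul0r.
rewrite -diagsumZ; apply: eq_diagsum => m n <-; exact: capp_term_Sl.
Qed.

Lemma cappX_small k : (k < 2)%N -> cappX k = 0.
Proof. by move=> k2; apply: diagsum_small_l => // n; rewrite subrr mul0r. Qed.

Lemma cappY_SSSS k : cappY k.+4 = q ^+ 8 * (q ^+ k) ^+ 4 * capp k.
Proof.
rewrite /cappY diagsum_shift_l; last by move=> n; rewrite subrr mul0r.
rewrite diagsum_shift_l; last by move=> n; rewrite subrr mul0r.
rewrite -diagsumZ; apply: eq_diagsum => m n <- /=.
rewrite capp_term_Sl mulrCA capp_term_Sl mulnS -addnA exprD; ring.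
Qed.

Lemma cappY_small k : (k < 4)%N -> cappY k = 0.
Proof.
have [k2 _|] := ltnP k 2.
  by apply: diagsum_small_l => // n; rewrite subrr mul0r.
case: k => [|[|k]] // _ k4.
rewrite /cappY diagsum_shift_l; last by move=> n; rewrite subrr mul0r.
by apply: diagsum_small_l => // n; rewrite subrr mul0r.
Qed.

Lemma cappZ_SSS k : cappZ k.+3 = q ^+ 6 * (q ^+ k) ^+ 4 * capp k.
Proof.
rewrite /cappZ diagsum_shift_r; last first.
  by move=> m; rewrite muln0 subrr mulr0 mul0r.
rewrite -diagsumZ; apply: eq_diagsum => m n <-; exact: capp_term_Sr.
Qed.

Lemma cappZ_small k : (k < 3)%N -> cappZ k = 0.
Proof.
by move=> k3; apply: diagsum_small_r => // m; rewrite muln0 subrr mulr0 mul0r.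
Qed.

(** Multiplication of a generating function by its variable; the value 0 at index 0 lets a
    recurrence be stated for every k. *)
Definition shift (a : nat -> F) (k : nat) : F := if k is k'.+1 then a k' else 0.

Definition capp_defect (k : nat) : F :=
  (1 - q ^+ k) * capp k
  - shift (fun i => q * (q ^+ i * capp i - (q ^+ i) ^+ 2 * capp i)) k
  - shift (shift (fun i =>
      q ^+ 2 * ((q ^+ i) ^+ 2 * capp i + q * ((q ^+ i) ^+ 3 * capp i)))) k
  + shift (shift (shift (fun i => q ^+ 5 * ((q ^+ i) ^+ 3 * capp i)))) k.

(* The fourth-order recurrence [capp_split] factors through this third-order
   one, the left factor being the first-order operator V_k + q^k V_{k-1}. *)
Lemma capp_defect_eq0 k : capp_defect k = 0.
Proof.
elim: k => [|k IH]; first by rewrite /capp_defect /= expr0; ring.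
suff: capp_defect k.+1 + q ^+ k.+1 * capp_defect k = 0.
  by rewrite IH mulr0 addr0.
(* The cases reflect that the X, Z and Y terms set in at indices 2, 3 and 4. *)
rewrite /capp_defect capp_split; case: k {IH} => [|[|[|k]]].
- by rewrite cappX_small // cappY_small // cappZ_small //= expr0; ring.
- by rewrite cappX_SS // cappY_small // cappZ_small //= expr0; ring.
- by rewrite cappX_SS // cappY_small // cappZ_SSS //= expr0; ring.
- by rewrite cappX_SS // cappY_SSSS // cappZ_SSS //= !exprS; ring.
Qed.


(** * Convolution of c_k with 1/(q)_k *)

(** The cut-off [B] is harmless once s < B, as [qpochV] vanishes at negative arguments. The exponent
    j makes room for multiplication by powers of q^s. *)
Definition cappconv B j (s : int) : F :=
  \sum_(k < B) (q ^+ k) ^+ j * capp k * e (s - k%:Z).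

Lemma cappconv_neg B j (s : int) : s < 0 -> cappconv B j s = 0.
Proof.
by move=> s0; rewrite /cappconv big1 // => k _; rewrite qpochV_neg ?mulr0 //; lia.
Qed.

(** With d = s - i - k, q^s = q^i q^k q^d and q^d / (q)_d = 1/(q)_d - 1/(q)_(d-1). The offset [p]
    removes a common q^p without dividing by q, which may be 0. *)
Lemma cappconv_mul B j (s p i : nat) : (p <= i)%N -> (p <= s)%N ->
  q ^+ (s - p) * cappconv B j (s%:Z - i%:Z)
  = q ^+ (i - p) * (cappconv B j.+1 (s%:Z - i%:Z)
                    - cappconv B j.+1 (s%:Z - i.+1%:Z)).
Proof.
move=> pi ps; rewrite /cappconv -sumrB !mulr_sumr; apply: eq_bigr => k _.
have [ks|sk] := leqP (i + k)%N s.
  pose d := (s - (i + k))%N.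
  have -> : s%:Z - i%:Z - k%:Z = d by lia.
  have -> : s%:Z - i.+1%:Z - k%:Z = d%:Z - 1 by lia.
  rewrite qpochV_pred //.
  have -> : (s - p = (i - p) + k + d)%N by lia.
  by rewrite !exprD exprS; ring.
rewrite (qpochV_neg (_ : s%:Z - i%:Z - k%:Z < 0)); last by lia.
rewrite (qpochV_neg (_ : s%:Z - i.+1%:Z - k%:Z < 0)); last by lia.
by rewrite !mulr0 subrr mulr0.
Qed.

Lemma sum_shift B (a : nat -> F) (s : int) : s < B%:Z ->
  \sum_(k < B) shift a k * e (s - k%:Z) = \sum_(k < B) a k * e (s - 1 - k%:Z).
Proof.
case: B => [|B] sB; first by rewrite !big_ord0.
rewrite big_ord_recl mul0r add0r [RHS]big_ord_recr /=.
rewrite (qpochV_neg (_ : s - 1 - B%:Z < 0)) ?mulr0 ?addr0; last by lia.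
by apply: eq_bigr => k _; rewrite /bump /=; congr (_ * e _); lia.
Qed.

(** [capp_defect_eq0] convolved with 1/(q)_k: every [shift] lowers s by one, every factor q^k raises
    j by one. *)
Lemma cappconv_defect B (s : int) : s < B%:Z ->
  cappconv B 0 s = cappconv B 1 s
    + q * (cappconv B 1 (s - 1) - cappconv B 2 (s - 1))
    + q ^+ 2 * (cappconv B 2 (s - 2) + q * cappconv B 3 (s - 2))
    - q ^+ 5 * cappconv B 3 (s - 3).
Proof.
move=> sB; apply/eqP; rewrite -subr_eq0; apply/eqP.
transitivity (\sum_(k < B) capp_defect k * e (s - k%:Z)); last first.
  by rewrite big1 // => k _; rewrite capp_defect_eq0 mul0r.
rewrite /capp_defect; under eq_bigr do rewrite mulrDl !mulrBl.
rewrite big_split !sumrB /=.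
rewrite !sum_shift; try lia.
rewrite (_ : s - 1 - 1 = s - 2); last by lia.
rewrite (_ : s - 2 - 1 = s - 3); last by lia.
rewrite /cappconv.
have E1 : \sum_(k < B) q * (q ^+ k * capp k - q ^+ k ^+ 2 * capp k)
    * e (s - 1 - k%:Z)
  = q * (\sum_(k < B) q ^+ k ^+ 1 * capp k * e (s - 1 - k%:Z)
         - \sum_(k < B) q ^+ k ^+ 2 * capp k * e (s - 1 - k%:Z)).
  by rewrite -sumrB mulr_sumr; apply: eq_bigr => k _; ring.
have E2 : \sum_(k < B) q ^+ 2 * (q ^+ k ^+ 2 * capp k
    + q * (q ^+ k ^+ 3 * capp k)) * e (s - 2 - k%:Z)
  = q ^+ 2 * (\sum_(k < B) q ^+ k ^+ 2 * capp k * e (s - 2 - k%:Z)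
         + q * \sum_(k < B) q ^+ k ^+ 3 * capp k * e (s - 2 - k%:Z)).
  rewrite [q * \sum_(_ < _) _]mulr_sumr -big_split mulr_sumr.
  by apply: eq_bigr => k _ /=; ring.
have E3 : \sum_(k < B) q ^+ 5 * (q ^+ k ^+ 3 * capp k) * e (s - 3 - k%:Z)
  = q ^+ 5 * \sum_(k < B) q ^+ k ^+ 3 * capp k * e (s - 3 - k%:Z).
  by rewrite mulr_sumr; apply: eq_bigr => k _; ring.
have E4 : \sum_(k < B) q ^+ k * capp k * e (s - k%:Z)
  = \sum_(k < B) q ^+ k ^+ 1 * capp k * e (s - k%:Z).
  by apply: eq_bigr => k _; rewrite expr1.
have E0 : \sum_(k < B) 1 * capp k * e (s - k%:Z)
  = \sum_(k < B) q ^+ k ^+ 0 * capp k * e (s - k%:Z).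
  by apply: eq_bigr => k _; rewrite expr0.
by rewrite E0 E1 E2 E3 E4; ring.
Qed.

(** [cappconv_mul] absorbs the powers of q^r, and [cappconv_defect] removes j = 0. Both sides become
    combinations of convolutions with 1 <= j <= 3 whose coefficients depend on q alone, and these
    agree. *)
Lemma cappconv_rec B (r : nat) : (r.+1 < B)%N ->
  (1 - q ^+ r.+1) * cappconv B 0 r.+1
  = (1 + q - q ^+ (2 * r + 1)) * cappconv B 0 r
    - (1 + q ^+ r) * (q - q ^+ (2 * r)) * cappconv B 0 (r%:Z - 1).
Proof.
move=> rB; pose a j i := cappconv B j (r.+1%:Z - i%:Z).
have -> : cappconv B 0 r.+1 = a 0%N 0%N by rewrite /a subr0.
have -> : cappconv B 0 r = a 0%N 1%N by congr cappconv; lia.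
have -> : cappconv B 0 (r%:Z - 1) = a 0%N 2%N by congr cappconv; lia.
have def i : a 0%N i = a 1%N i + q * (a 1%N i.+1 - a 2%N i.+1)
    + q ^+ 2 * (a 2%N i.+2 + q * a 3%N i.+2) - q ^+ 5 * a 3%N i.+3.
  rewrite /a cappconv_defect; last by lia.
  by do ! congr (_ + _); do ? congr (_ * _); do ? congr (- _);
     do ? congr (_ + _); do ? congr (_ * _); do ? congr (- _);
     congr cappconv; lia.
have mul0 j : q ^+ r.+1 * a j 0%N = a j.+1 0%N - a j.+1 1%N.
  by have := @cappconv_mul B j r.+1 0 0 isT isT; rewrite expr0 mul1r.
have mul1 j i : q ^+ r * a j i.+1 = q ^+ i * (a j.+1 i.+1 - a j.+1 i.+2).
  by have := @cappconv_mul B j r.+1 1 i.+1 isT isT; rewrite !subn1.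
have sq j i : (q ^+ r) ^+ 2 * a j i.+1
    = q ^+ i * (q ^+ i * (a j.+2 i.+1 - a j.+2 i.+2)
                - q ^+ i.+1 * (a j.+2 i.+2 - a j.+2 i.+3)).
  by rewrite expr2 -mulrA mul1 mulrCA mulrBr !mul1.
have cb j i : (q ^+ r) ^+ 3 * a j i.+1
    = q ^+ i * (q ^+ i * (q ^+ i * (a j.+3 i.+1 - a j.+3 i.+2)
                          - q ^+ i.+1 * (a j.+3 i.+2 - a j.+3 i.+3))
       - q ^+ i.+1 * (q ^+ i.+1 * (a j.+3 i.+2 - a j.+3 i.+3)
                      - q ^+ i.+2 * (a j.+3 i.+3 - a j.+3 i.+4))).
  by rewrite exprS -mulrA sq mulrCA mulrBr ![q ^+ r * (_ * _)]mulrCA !mulrBr !mul1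
             -!mulrBr.
rewrite mulrBl mul0 addn1 exprS mul2n -addnn exprD.
transitivity ((1 + q) * a 0%N 1%N - q * ((q ^+ r) ^+ 2 * a 0%N 1%N)
  - (q * a 0%N 2%N + q * (q ^+ r * a 0%N 2%N) - (q ^+ r) ^+ 2 * a 0%N 2%N
     - (q ^+ r) ^+ 3 * a 0%N 2%N)); last by ring.
rewrite cb !sq mul1 !def; ring.
Qed.


Lemma cappconv_box B (r : nat) : (r < B)%N ->
  \sum_(m < B) \sum_(n < B) capp_term m n * e (r%:Z - 3 * n%:Z - 2 * m%:Z)
  = cappconv B 0 r.
Proof.
move=> rB; rewrite /cappconv.
under [RHS]eq_bigr => k _ do
  rewrite expr0 mul1r /capp -(diagsum_box capp_term (ltn_ord k) (ltn_ord k)) mulr_suml.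
rewrite [RHS]exchange_big /=; apply: eq_bigr => m _.
under [RHS]eq_bigr do rewrite mulr_suml.
rewrite [RHS]exchange_big /=; apply: eq_bigr => n _.
have [kB|Bk] := ltnP (2 * m + 3 * n) B.
  rewrite (bigD1 (Ordinal kB)) //= eqxx mul1r big1 ?addr0.
    by congr (_ * e _); lia.
  move=> k nk; rewrite (_ : (_ == _) = false) ?mul0r //.
  by apply: contraNF nk => /eqP E; apply/eqP/val_inj.
rewrite (qpochV_neg (_ : _ < 0)) ?mulr0; last by lia.
rewrite big1 // => k _; have := ltn_ord k.
by case: eqP => [<-|_ _]; rewrite ?mul0r //; lia.
Qed.

(** * Identification of the two sides *)

Lemma capp0 : capp 0 = 1.
Proof.
rewrite /capp /diagsum !big_ord1 /= /capp_term.
by rewrite expr0 !qpoch0 mulr1 invr1 !mulr1.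
Qed.

Lemma jsum_neg N k (r : int) : r < 0 -> jsum N k r = 0.
Proof.
move=> r0; rewrite /jsum /wsum big1 // => i _; set j : int := _ - _.
have [j0|j0] := leP 0 j.
  by rewrite (qpochV_neg (_ : r - j < 0)) ?mul0r ?mulr0 //; lia.
by rewrite (qpochV_neg (_ : r + j < 0)) ?mulr0 //; lia.
Qed.

Lemma jsum0 N : jsum N 1 0%N = 1.
Proof.
have NN : (N < (2 * N).+1)%N by lia.
have term0 : jweight 0 * qsqbin 0%N 0 = 1.
  have -> : qsqbin 0%N 0 = q ^+ 0 * (e 0%N * e 0%N) by [].
  by rewrite qpochV0 expr0 !mulr1.
rewrite jsum1E /wsum (bigD1 (Ordinal NN)) //= subrr term0 big1 ?addr0 // => i iN.
rewrite qsqbin_eq0 ?mulr0 //.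
have : nat_of_ord i <> N by move=> E; case/eqP: iN; apply: val_inj.
by lia.
Qed.

Definition conv_factor (r : nat) := qpoch q q (2 * r) * e r.

Lemma conv_factorS r : (1 - q ^+ r.+1) * conv_factor r.+1
  = (1 - q ^+ (2 * r + 2)) * (1 - q ^+ (2 * r + 1)) * conv_factor r.
Proof.
rewrite /conv_factor mulrCA -qpochVS // mulnS !qpochS -!exprS addn1 addn2.
by ring.
Qed.

(** Both sides are 1 at r = 0, the terms at r = -1 vanish, and [conv_factorS] converts [jsum_rec]
    into [cappconv_rec]. *)
Lemma cappconv_jsum N B (r : nat) : (r <= N)%N -> (r < B)%N ->
  cappconv B 0 r = conv_factor r * jsum N 1 r.
Proof.
have nz k : 1 - q ^+ k.+1 != 0 by rewrite subr_eq0 eq_sym q_nroot.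
elim/ltn_ind: r => -[_ _|r IH rN rB].
  rewrite jsum0 /conv_factor muln0 qpoch0 qpochV0 !mulr1 => {N}.
  case: B => // B; rewrite /cappconv big_ord_recl big1 ?addr0.
    by move=> _; rewrite qpochV0 capp0 !mulr1.
  by move=> i _; rewrite qpochV_neg ?mulr0 //; rewrite /bump /=; lia.
apply: (mulfI (nz r)).
rewrite cappconv_rec // IH ?(ltnW rN) ?(ltnW rB) //.
rewrite [RHS]mulrA conv_factorS [RHS]mulrAC jsum_rec //.
(* For r >= 1 this rests on q [conv_factor r] = (1 + q^r)(q - q^(2r)) [conv_factor (r - 1)], which
   is [conv_factorS] with 1 - q^r cancelled. *)
suff -> : (1 + q ^+ r) * (q - q ^+ (2 * r)) * cappconv B 0 (r%:Z - 1)
          = conv_factor r * q * jsum N 1 (r%:Z - 1) by ring.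
case: r IH rN rB => [|r] IH rN rB.
  by rewrite cappconv_neg // jsum_neg // !mulr0.
rewrite (_ : r.+1%:Z - 1 = r); last by lia.
rewrite IH; try lia.
apply: (mulfI (nz r)); rewrite -[conv_factor r.+1 * q * _]mulrA [RHS]mulrA conv_factorS.
rewrite mulnS !add2n !exprS addn2 addn1 !exprS mul2n -addnn exprD.
by ring.
Qed.

Lemma capparelli_core N (r : nat) : (r <= N)%N ->
  qpoch q q r / qpoch q q (2 * r)
  * \sum_(m < N.+1) \sum_(n < N.+1)
      capp_term m n * e (r%:Z - 3 * n%:Z - 2 * m%:Z)
  = jsum N 1 r.
Proof.
move=> rN; rewrite cappconv_box ?ltnS // (cappconv_jsum rN) ?ltnS // /conv_factor.
have ->: e r = (qpoch q q r)^-1 by [].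
by field; rewrite !qpoch_neq0.
Qed.

(** * Iteration of the Bailey step over the tuple *)

(** Without the constant (q)_(2L), L enters only through 1/(q)_(L-N_1), and lengthening the tuple
    acts by the kernel of [bailey_step]. *)
Definition rsummand (f : nat) (L m n : nat) (ns : f.-tuple nat) : F :=
  q ^+ (\sum_(1 <= i < f.+1) Nidx ns i ^ 2)%N
  * (qpoch q q (nidx ns f) / qpoch q q (2 * nidx ns f)
     / \prod_(1 <= i < f) qpoch q q (nidx ns i))
  * e (L%:Z - (Nidx ns 1)%:Z)
  * (capp_term m n * e ((nidx ns f)%:Z - 3 * n%:Z - 2 * m%:Z)).

Lemma summandE f L m n (ns : f.-tuple nat) :
  summand q L m n ns = qpoch q q (2 * L) * rsummand L m n ns.
Proof.
rewrite /summand /rsummand /capp_term exprD.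
set P := \prod_(_ <= _ < _) _.
have nzP : P != 0.
  by rewrite prodf_seq_neq0; apply/allP => i _ /=; exact: qpoch_neq0.
by field; rewrite nzP !qpoch_neq0 // qpoch_cube_neq0.
Qed.

Lemma nidx_cons f a (t : f.-tuple nat) i : (0 < i)%N ->
  nidx (cons_tuple a t) i.+1 = nidx t i.
Proof. by case: i. Qed.

Lemma Nidx_cons f a (t : f.-tuple nat) i : (0 < i)%N ->
  Nidx (cons_tuple a t) i.+1 = Nidx t i.
Proof.
move=> i0; rewrite /Nidx big_add1 /= [LHS]big_nat [RHS]big_nat.
apply: eq_bigr => k /andP[ik _]; rewrite nidx_cons //; lia.
Qed.

Lemma Nidx1 f (t : f.-tuple nat) : Nidx t 1 = sumn t.
Proof.
by rewrite /Nidx big_add1 sumnE [RHS](big_nth 0%N) size_tuple.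
Qed.

(** Here r is N_1 of the longer tuple and [sumn t] its N_2. The factor 1/(q)_(n_1) reappears as
    1/(q)_(r - N_2) inside [rsummand r m n t]. *)
Lemma rsummand_cons f L m n a (t : f.+1.-tuple nat) (r := (a + sumn t)%N) :
  rsummand L m n (cons_tuple a t)
  = q ^+ (r ^ 2) * e (L%:Z - r%:Z) * rsummand r m n t.
Proof.
rewrite /rsummand !Nidx1 big_nat_recl // Nidx1 /= -/r.
have -> : (\sum_(1 <= i < f.+2) Nidx (cons_tuple a t) i.+1 ^ 2
           = \sum_(1 <= i < f.+2) Nidx t i ^ 2)%N.
  by rewrite [LHS]big_nat [RHS]big_nat; apply: eq_bigr => i /andP[i0 _];
     rewrite Nidx_cons.
have -> : \prod_(1 <= i < f.+2) qpoch q q (nidx (cons_tuple a t) i)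
          = qpoch q q a * \prod_(1 <= i < f.+1) qpoch q q (nidx t i).
  rewrite big_nat_recl //; congr (_ * _).
  by rewrite [LHS]big_nat [RHS]big_nat; apply: eq_bigr => i /andP[i0 _];
     rewrite nidx_cons.
rewrite nidx_cons // exprD invfM.
have -> : r%:Z - (sumn t)%:Z = a by lia.
have -> : e a = (qpoch q q a)^-1 by [].
by ring.
Qed.

Fixpoint tuple_box (B f : nat) : seq (f.-tuple nat) :=
  if f is f'.+1 then
    [seq cons_tuple a t | a <- index_iota 0 B, t <- tuple_box B f']
  else [:: [tuple]].

Lemma tuple_box_uniq B f : uniq (tuple_box B f).
Proof.
elim: f => //= f IH; apply: allpairs_uniq => //; first exact: iota_uniq.
by move=> [a t] [b u] _ _ /= /(congr1 val) /= [-> /val_inj ->].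
Qed.

Lemma mem_tuple_box B f (t : f.-tuple nat) :
  all (fun a => a < B)%N t -> t \in tuple_box B f.
Proof.
elim: f t => [|f IH] t; first by rewrite (tuple0 t).
case/tupleP: t => a t /= /andP[aB tB]; apply/allpairsP; exists (a, t) => /=.
by split; [rewrite mem_index_iota | exact: IH | exact: val_inj].
Qed.

Lemma big_tuple_box_cons B f (phi : f.+1.-tuple nat -> F) :
  \sum_(t <- tuple_box B f.+1) phi t
  = \sum_(a < B) \sum_(t <- tuple_box B f) phi (cons_tuple (a : nat) t).
Proof. by rewrite /= big_allpairs_dep big_mkord. Qed.

Lemma sum_translate B s (phi : nat -> F) :
  (forall r, (r < s)%N -> phi r = 0) -> (forall r, (B <= r)%N -> phi r = 0) ->
  \sum_(a < B) phi (a + s)%N = \sum_(r < B) phi r.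
Proof.
move=> phi_lo phi_hi; rewrite -(@sum_ord_trunc B (B + s)) ?leq_addr //.
rewrite -[RHS](big_mkord xpredT) (@big_cat_nat _ _ _ s) ?leq_addl //=.
rewrite [X in X + _]big_nat [X in X + _]big1 ?add0r => [|r /andP[_ /phi_lo]//].
by rewrite -{2}[s]add0n big_addn addnK big_mkord.
Qed.

(** Induction on f with L free: once the outer sum runs over r = N_1 instead of n_1, the inner sums
    are the same statement with r for L. The base case is [capparelli_core] under one Bailey
    step. *)
Lemma sum_rsummand N f (L : nat) : (L <= N)%N ->
  \sum_(t <- tuple_box N.+1 f.+1) \sum_(m < N.+1) \sum_(n < N.+1)
    rsummand L m n t
  = jsum N f.+2 L.
Proof.
elim: f L => [|f IH] L LN; rewrite (@jsum_bailey _ N.+1) ?ltnS //.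
  rewrite big_tuple_box_cons; apply: eq_bigr => a _; rewrite big_seq1.
  have aN : (a <= N)%N by rewrite -ltnS.
  rewrite -(capparelli_core aN) !mulr_sumr; apply: eq_bigr => m _.
  rewrite !mulr_sumr; apply: eq_bigr => n _.
  rewrite /rsummand /Nidx /nidx !big_nat1 /= big_geq //.
  by rewrite invr1 mulr1; ring.
pose g r t := q ^+ (r ^ 2) * e (L%:Z - r%:Z)
  * \sum_(m < N.+1) \sum_(n < N.+1) rsummand r m n (t : f.+1.-tuple nat).
transitivity (\sum_(a < N.+1) \sum_(t <- tuple_box N.+1 f.+1)
                g (a + sumn t)%N t).
  rewrite big_tuple_box_cons; apply: eq_bigr => a _; apply: eq_bigr => t _.
  rewrite /g mulr_sumr; apply: eq_bigr => m _.
  by rewrite mulr_sumr; apply: eq_bigr => n _; rewrite rsummand_cons.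
rewrite exchange_big /=.
transitivity (\sum_(t <- tuple_box N.+1 f.+1) \sum_(r < N.+1) g r t).
  (* Extending r to the whole range costs nothing: 1/(q)_(r - [sumn t]) vanishes for r < [sumn t],
     and 1/(q)_(L - r) for r > N >= L. *)
  apply: eq_bigr => t _; apply: (@sum_translate _ _ (g ^~ t)) => r rlt; rewrite /g.
    rewrite big1 ?mulr0 // => m _; rewrite big1 // => n _.
    by rewrite /rsummand Nidx1 qpochV_neg ?mulr0 ?mul0r //; lia.
  by rewrite qpochV_neg ?mulr0 ?mul0r //; lia.
rewrite exchange_big /=; apply: eq_bigr => r _.
by rewrite -mulr_sumr IH // -ltnS.
Qed.

(** * Finite support and the final summation *)

(** A nonzero term requires 2m + 3n <= n_f <= N_1 <= L, which bounds every index by L. *)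
Lemma summand_eq0 f L m n (t : f.+1.-tuple nat) :
  ~~ [&& all (fun a => a < L.+1)%N t, (m < L.+1)%N & (n < L.+1)%N] ->
  summand q L m n t = 0.
Proof.
have le_sumn (s : seq nat) a : a \in s -> (a <= sumn s)%N.
  elim: s => //= b s IHs; rewrite inE => /orP[/eqP ->|/IHs]; first exact: leq_addr.
  by move/leq_trans; apply; exact: leq_addl.
move=> out; rewrite summandE /rsummand Nidx1.
have [Lt|tL] := ltnP L (sumn t).
  by rewrite (qpochV_neg (_ : L%:Z - _ < 0)) ?mulr0 ?mul0r ?mulr0 //; lia.
have last_le : (nidx t f.+1 <= sumn t)%N.
  by apply: le_sumn; apply: mem_nth; rewrite size_tuple.
rewrite [e (_ - 3 * _ - _)]qpochV_neg ?mulr0 // ltNge; apply: contra out => mn.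
apply/and3P; split; [|lia|lia].
by apply/allP => a /le_sumn; lia.
Qed.

Lemma qbinom_jsum_term f L (i : nat) (j := i%:Z - L%:Z) : (i <= 2 * L)%N ->
  (jacobi3 (j + 1))%:~R * q ^ (f.+1%:Z * j ^+ 2) * qbinom q (2 * L)%:Z (L%:Z - j)
  = qpoch q q (2 * L)
    * (jweight j * q ^+ (f.+1 * `|j| ^ 2) * (e (L%:Z - j) * e (L%:Z + j))).
Proof.
move=> iL.
have -> : f.+1%:Z * j ^+ 2 = (f.+1 * `|j| ^ 2)%N by nia.
have -> : L%:Z - j = (2 * L - i)%N by lia.
have -> : L%:Z + j = i by lia.
rewrite /qbinom (_ : (2 * L)%:Z - (2 * L - i)%N%:Z = i); last by lia.
rewrite subnK // invfM -/(jweight j) /qpochV -exprnP.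
by ring.
Qed.

End QSeries.

Local Open Scope classical_set_scope.

(* \sum_(x \in A) is the sum of a finitely supported family over a possibly
   infinite set A.  The hypothesis on q makes every (q; q)_n and
   (q^3; q^3)_n nonzero; it holds for an indeterminate and for complex
   |q| < 1. *)
Theorem theorem21 (F : fieldType) (q : F)
    (q_not_root_of_unity : forall k : nat, (0 < k)%N -> q ^+ k != 1)
    (L f : nat) (f_gt0 : (0 < f)%N) :
  \sum_(x \in [set: (nat * nat * f.-tuple nat)%type])
      summand q L x.1.1 x.1.2 x.2
  = \sum_(j \in [set j : int | (- L%:Z <= j <= L%:Z)%R])
      (jacobi3 (j + 1))%:~R * q ^ (f.+1%:Z * j ^+ 2)
      * qbinom q (2 * L)%:Z (L%:Z - j).
Proof.
case: f f_gt0 => // f _.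
pose pairs := [seq (m, n) | m <- index_iota 0 L.+1, n <- index_iota 0 L.+1].
pose box := [seq (p, t) | t <- tuple_box L.+1 f.+1, p <- pairs].
rewrite (fsbigE box) //=; first last.
- move=> [[m n] t] _ /= out; apply: summand_eq0 => //.
  apply: contra out => /and3P[tL mL nL].
  apply/allpairsP; exists (t, (m, n)); split=> //; first exact: mem_tuple_box.
  by apply/allpairsP; exists (m, n); rewrite !mem_index_iota.
- apply: allpairs_uniq; first exact: tuple_box_uniq.
    by apply: allpairs_uniq; rewrite ?iota_uniq // => -[? ?] [? ?].
  by move=> [t p] [u r] _ _ [-> ->].
have inj_sub : injective (fun i : nat => i%:Z - L%:Z) by move=> i j; lia.
rewrite [RHS](fsbigE [seq i%:Z - L%:Z | i <- index_iota 0 (2 * L).+1]); first last.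
- move=> j /andP[jL jU] /negP[]; apply/mapP; exists `|(j + L%:Z)%R|%N; last by lia.
  by rewrite mem_index_iota; lia.
- by move=> j /mapP[i]; rewrite mem_index_iota => iL -> /=; lia.
- by rewrite map_inj_uniq // iota_uniq.
(* The common value of both sides; the window N = L is exactly the range of j. *)
transitivity (qpoch q q (2 * L) * jsum q L f.+2 L); last first.
  rewrite big_mkcond big_map big_mkord /jsum /wsum mulr_sumr.
  apply: eq_bigr => i _; have iL : (i <= 2 * L)%N by rewrite -ltnS.
  by rewrite mem_set ?qbinom_jsum_term //=; lia.
rewrite -(sum_rsummand q_not_root_of_unity f (leqnn L)) mulr_sumr.
rewrite big_mkcond /= big_allpairs_dep; apply: eq_bigr => t _.
rewrite big_allpairs_dep big_mkord mulr_sumr; apply: eq_bigr => m _.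
rewrite big_mkord mulr_sumr; apply: eq_bigr => n _ /=.
by rewrite in_setT summandE.
Qed.
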